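(* Suppose there are constants $a,C>0$ such that the heat kernel $p(t,x,y)$ of $X$ satisfies $$p(t,x,y)\ge\frac{C\,t}{V(d(x,y))\,\phi(d(x,y))}\quad\text{whenever } d(x,y)\ge\phi^{-1}(t),$$ for every $x\in M\setminus\mathscr N$, $\mu$-almost all $y\in M$ and all $t\in(a,\infty)$, where $V$ and $\phi$ are strictly increasing functions on $(0,\infty)$ such that, for some constants $c_1,c_2>0$, $d_2\ge d_1>0$ and $c>1$, $$c_1\Big(\frac Rr\Big)^{d_1}\le\frac{V(R)}{V(r)}\le c_2\Big(\frac Rr\Big)^{d_2}\ \ (0<r<R<\infty),\qquad \phi(2r)\le c\,\phi(r)\ \ (r>0).$$ If $\varphi:(1,\infty)\to(0,\infty)$ is an increasing function satisfying $\int_1^\infty\frac{1}{\phi(\varphi(t))}\,dt=\infty$, then for all $x\in M\setminus\mathscr N$, $\mathbf P^x$-a.s., $$\limsup_{t\to\infty}\frac{\sup_{0<s\le t}d(X_s,x)}{\varphi(t)}=\limsup_{t\to\infty}\frac{d(X_t,x)}{\varphi(t)}=\infty.$$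
   Context: $(M,d)$ is a locally compact, separable, connected metric space in which every ball $B(x,r)=\{y:d(x,y)<r\}$ is relatively compact, and $\mu$ is a Radon measure on $M$ with full support such that $C_*^{-1}V(r)\le\mu(B(x,r))\le C_*V(r)$ for all $x\in M$, $r>0$, where $C_*\ge1$ and $V:(0,\infty)\to(0,\infty)$ is strictly increasing with $V(0)=0$, $V(\infty)=\infty$. Also $\phi:(0,\infty)\to(0,\infty)$, and $\phi^{-1}$ is its inverse function. $(\mathscr E,\mathscr F)$ is a symmetric regular Dirichlet form on $L^2(M,\mu)$ of pure-jump type: there is a symmetric Radon measure $n(\cdot,\cdot)$ on $M\times M\setminus\mathrm{diag}$ with $\mathscr E(u,v)=\int_{M\times M\setminus \mathrm{diag}}(u(x)-u(y))(v(x)-v(y))\,n(dx,dy)$ for $u,v\in\mathscr F\cap C_c(M)$. $X=(X_t,t\ge0;\mathbf P^x;\mathscr F_t)$ is the associated Hunt process, uniquely determined for starting points outside a properly exceptional set $\mathscr N\subset M$, with semigroup $(P_t)$. A heat kernel is a non-negative symmetric measurable function $p$ on $(0,\infty)\times M\times M$ with $P_tf(x)=\int p(t,x,z)f(z)\,\mu(dz)$ and $p(t+s,x,y)=\int p(t,x,z)p(s,z,y)\,\mu(dz)$ for all $s,t>0$, $x\in M\setminus\mathscr N$ and $\mu$-a.a. $y$.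
   Formalization: The condition that the integral of 1/φ(φ-rate(t)) over (1,∞) is infinite is read as divergence at infinity (over (T,∞) for every T>1); divergence only at t=1, possible when the rate function tends to 0 at 1, is excluded, since the claim then fails. *)

(* Defs.v *)
From HB Require Import structures.
From mathcomp Require Import all_boot all_order all_algebra.
From mathcomp Require Import all_classical all_reals all_analysis.
From mathcomp Require Import measurable_realfun.

Set Implicit Arguments.
Unset Strict Implicit.
Unset Printing Implicit Defensive.

Import Order.TTheory GRing.Theory Num.Theory.
Import numFieldNormedType.Exports.

Local Open Scope classical_set_scope.
Local Open Scope ring_scope.

(* Measurable types of the library are pointed; the point plays no other role
   than making the space nonempty. *)
#[short(type="pointedMetricType")]
HB.structure Definition PointedMetric (R : numDomainType) :=
  { M of Metric R M & Pointed M }.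

Notation borel T := (g_sigma_algebraType (@open T)).

Section Space.
Context {R : realType}.

(* Borel measures that are finite on the compact subsets of D and inner regular
   on D; for D open this is a Radon measure on the space D, since the compact
   subsets of the subspace D are the compact sets included in D. *)
Definition radon_on (T : topologicalType) (D : set T) (mu : set T -> \bar R)
    : Prop :=
  (forall K : set T, compact K -> K `<=` D -> (mu K < +oo)%E) /\
  (forall A : set T, <<s (@open T) >> A -> A `<=` D ->
    mu A = ereal_sup [set mu K | K in [set K : set T | compact K /\ K `<=` A]]).

Definition full_support (T : topologicalType) (mu : set T -> \bar R) : Prop :=
  forall U : set T, open U -> U !=set0 -> (0 < mu U)%E.

Definition separable (T : topologicalType) : Prop :=
  exists D : set T, countable D /\ dense D.

Definition off_diagonal (T : Type) : set (T * T) := [set z | z.1 <> z.2].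

End Space.

(* A Dirichlet form on L^2(M, mu).  Elements of L^2 are represented by
   functions; the domain F and the form E are saturated for mu-a.e. equality. *)
Section DirichletForm.
Context {R : realType} {M : ptopologicalType}.
Variable mu : {measure set (borel M) -> \bar R}.
Implicit Types (F : set (M -> R)) (E : (M -> R) -> (M -> R) -> R)
  (u v w : M -> R).

Definition L2 : set (M -> R) :=
  [set u | (u : borel M -> R) \in Lfun mu 2%:E].

Definition L2dot u v : R := \int[mu]_x (u x * v x).

Definition energy1 E u : R := E u u + L2dot u u.

Record dirichlet_form F E : Prop := {
  df_L2 : F `<=` L2 ;
  df_ae : forall u v, F u -> L2 v -> {ae mu, forall x, u x = v x} ->
    F v /\ forall w, F w -> E u w = E v w ;
  df_lin : forall (a : R) u v, F u -> F v -> F (fun x => a * u x + v x) ;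
  df_sym : forall u v, F u -> F v -> E u v = E v u ;
  df_bilin : forall (a : R) u v w, F u -> F v -> F w ->
    E (fun x => a * u x + v x) w = a * E u w + E v w ;
  df_ge0 : forall u, F u -> 0 <= E u u ;
  df_dense : forall u (e : R), L2 u -> 0 < e -> exists2 v, F v &
    L2dot (u \- v) (u \- v) < e ;
  df_closed : forall u_ : nat -> M -> R, (forall n, F (u_ n)) ->
    (forall e : R, 0 < e -> exists N : nat, forall m n, (N <= m)%N ->
      (N <= n)%N -> energy1 E (u_ m \- u_ n) < e) ->
    exists2 u, F u & energy1 E (u_ n \- u) @[n --> \oo] --> (0 : R) ;
  df_markov : forall u, F u ->
    let v := fun x => Num.min (Num.max (u x) 0) 1 in F v /\ E v v <= E u u
}.

Definition Cc : set (M -> R) :=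
  [set u | continuous u /\ compact (closure [set x | u x != 0])].

Definition regular_form F E : Prop :=
  (forall u (e : R), F u -> 0 < e -> exists2 v, (F `&` Cc) v &
    energy1 E (u \- v) < e) /\
  (forall u (e : R), Cc u -> 0 < e -> exists2 v, (F `&` Cc) v &
    forall x, `|u x - v x| < e).

Definition jump_measure F E (n : {measure set (borel (M * M)%type) -> \bar R})
    : Prop :=
  [/\ radon_on (@off_diagonal M) n,
      forall A : set (M * M), <<s (@open (M * M)%type) >> A ->
        A `<=` @off_diagonal M -> n ((fun z => (z.2, z.1)) @^-1` A) = n A &
      forall u v, (F `&` Cc) u -> (F `&` Cc) v ->
        ((E u v)%:E = \int[n]_(z in @off_diagonal M)
           ((u z.1 - u z.2) * (v z.1 - v z.2))%:E)%E].

Definition pure_jump F E : Prop := exists n, jump_measure F E n.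

End DirichletForm.

(* Processes on M with cemetery None, the point at infinity of the one-point
   compactification of M. *)
Notation cpt M := (one_point_compactification M).

Section HuntProcess.
Context {R : realType} {M : ptopologicalType}.
Context {dO : measure_display} {Omega : measurableType dO}.

Local Notation Mbar := (cpt M).
Local Notation bM := (borel Mbar).

(* Only nonnegative times are meaningful. *)
Variables (X : R -> Omega -> Mbar) (P : Mbar -> probability Omega R)
  (Ft : R -> set (set Omega)).

(* X_t for t in [0, +oo], with X_oo the cemetery. *)
Definition at_time (t : \bar R) (w : Omega) : Mbar :=
  if t is r%:E then X r w else None.

Record admissible_filtration : Prop := {
  af_salg : forall t : R, 0 <= t -> sigma_algebra [set: Omega] (Ft t) ;
  af_sub : forall t : R, 0 <= t -> Ft t `<=` measurable ;
  af_mono : forall s t : R, 0 <= s -> s <= t -> Ft s `<=` Ft t ;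
  af_right : forall t : R, 0 <= t ->
    \bigcap_(s in [set s | t < s]) Ft s `<=` Ft t ;
  af_adapted : forall (t : R) (B : set Mbar), 0 <= t ->
    <<s (@open Mbar) >> B -> Ft t (X t @^-1` B)
}.

Definition stopping_time (sigma : Omega -> \bar R) : Prop :=
  (forall w, (0 <= sigma w)%E) /\
  (forall t : R, 0 <= t -> Ft t [set w | (sigma w <= t%:E)%E]).

Definition stopped_sigma (sigma : Omega -> \bar R) : set (set Omega) :=
  [set A | measurable A /\
    forall t : R, 0 <= t -> Ft t (A `&` [set w | (sigma w <= t%:E)%E])].

(* The strong Markov property and quasi-left-continuity are stated under each
   P z; integrating in z gives them under every initial law. *)
Record hunt_process : Prop := {
  hp_filtration : admissible_filtration ;
  hp_kernel : forall (t : R) (B : set Mbar), 0 <= t ->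
    <<s (@open Mbar) >> B ->
    measurable_fun [set: bM] ((fun z => P z (X t @^-1` B)) : bM -> \bar R) ;
  hp_start : forall z : Mbar, P z (X 0 @^-1` [set z]) = 1%E ;
  hp_cemetery : forall (s t : R) w, 0 <= s -> s <= t ->
    X s w = None -> X t w = None ;
  hp_shift : forall t : R, 0 <= t -> exists theta : Omega -> Omega,
    forall (s : R) w, 0 <= s -> X s (theta w) = X (s + t) w ;
  hp_right_cont : forall (t : R) w, 0 <= t -> X s w @[s --> t^'+] --> X t w ;
  hp_left_lim : forall (t : R) w, 0 < t ->
    exists l : Mbar, X s w @[s --> t^'-] --> l ;
  hp_strong_markov : forall (z : Mbar) (sigma : Omega -> \bar R)
      (A : set Omega) (s : R) (B : set Mbar),
    stopping_time sigma -> stopped_sigma sigma A -> 0 <= s ->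
    <<s (@open Mbar) >> B ->
    P z (A `&` [set w | B (at_time (sigma w + s%:E)%E w)]) =
    (\int[P z]_(w in A) P (at_time (sigma w) w) (X s @^-1` B))%E ;
  hp_quasi_left_cont : forall (z : Mbar) (sigma_ : nat -> Omega -> \bar R)
      (sigma : Omega -> \bar R),
    (forall n, stopping_time (sigma_ n)) ->
    (forall n w, (sigma_ n w <= sigma_ n.+1 w)%E) ->
    (forall w, sigma_ n w @[n --> \oo] --> sigma w) ->
    {ae P z, forall w, (sigma w < +oo)%E ->
      at_time (sigma_ n w) w @[n --> \oo] --> at_time (sigma w) w}
}.

(* Functions on M are extended by 0 to the cemetery. *)
Definition semigroup (t : R) (f : M -> \bar R) (x : M) : \bar R :=
  (\int[P (Some x)]_w (if X t w is Some y then f y else 0))%E.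

Definition semigroupR (t : R) (u : M -> R) (x : M) : R :=
  fine (semigroup t (EFin \o u) x).

Variable mu : {measure set (borel M) -> \bar R}.

(* X is mu-symmetric and its Dirichlet form is (E, F):
   F = { u in L^2 | lim_(t -> 0) (u - P_t u, u) / t < oo },
   E(u, v) = lim_(t -> 0) (u - P_t u, v) / t. *)
Record associated (F : set (M -> R)) (E : (M -> R) -> (M -> R) -> R) : Prop := {
  as_sym : forall (t : R) (f g : M -> \bar R), 0 < t ->
    measurable_fun [set: borel M] (f : borel M -> \bar R) ->
    measurable_fun [set: borel M] (g : borel M -> \bar R) ->
    (forall x, 0 <= f x)%E -> (forall x, 0 <= g x)%E ->
    (\int[mu]_x (semigroup t f x * g x) =
     \int[mu]_x (f x * semigroup t g x))%E ;
  as_dom : forall u, L2 mu u ->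
    (F u <-> cvg (t^-1 * L2dot mu (u \- semigroupR t u) u @[t --> 0^'+])) ;
  as_form : forall u v, F u -> F v ->
    t^-1 * L2dot mu (u \- semigroupR t u) v @[t --> 0^'+] --> E u v
}.

(* P_nu (X_t in B2 \ B1 for some t) = 0 for the law P_nu = int P z nu(dz). *)
Definition nearly_borel (A : set Mbar) : Prop :=
  forall nu : probability bM R, exists B1 B2 : set Mbar,
    [/\ <<s (@open Mbar) >> B1, <<s (@open Mbar) >> B2,
        B1 `<=` A, A `<=` B2 &
        {ae nu, forall z, {ae P z, forall w,
           forall t : R, 0 <= t -> ~ (B2 `\` B1) (X t w)}}].

Record properly_exceptional (N : set M) : Prop := {
  pe_nearly_borel : nearly_borel (Some @` N) ;
  pe_null : mu.-negligible N ;
  pe_invariant : forall x, ~ N x -> {ae P (Some x), forall w,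
    forall y, N y ->
      (forall t : R, 0 <= t -> X t w <> Some y) /\
      (forall t : R, 0 < t -> ~ (X s w @[s --> t^'-] --> (Some y : Mbar)))}
}.

Record heat_kernel (N : set M) (p : R -> M -> M -> R) : Prop := {
  hk_ge0 : forall (t : R) x y, 0 < t -> 0 <= p t x y ;
  hk_sym : forall (t : R) x y, 0 < t -> p t x y = p t y x ;
  hk_meas : measurable_fun
    [set z : R * borel M * borel M | 0 < z.1.1]
    (fun z : R * borel M * borel M => p z.1.1 z.1.2 z.2) ;
  hk_density : forall (t : R) x (f : M -> \bar R), 0 < t -> ~ N x ->
    measurable_fun [set: borel M] (f : borel M -> \bar R) ->
    (forall y, 0 <= f y)%E ->
    (semigroup t f x = \int[mu]_z ((p t x z)%:E * f z))%E ;
  hk_CK : forall (s t : R) x, 0 < s -> 0 < t -> ~ N x ->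
    {ae mu, forall y,
      ((p (t + s) x y)%:E = \int[mu]_z (p t x z * p s z y)%:E)%E}
}.

End HuntProcess.

(* The distance to x of a point of the compactification.  When all balls of M
   are relatively compact and M is unbounded, the value +oo at the cemetery is
   the only one for which this function is continuous. *)
Definition dist_to {R : realType} {M : pointedMetricType R} (x : M) (z : cpt M)
    : \bar R :=
  if z is Some y then (mdist y x)%:E else +oo%E.

(* Main.v *)
(* Fix b = a + 1.  From any starting point y outside N the heat kernel bound
   puts mass at least kappa / phi r on ball y (K r) \ (ball y r U ball x r), so
   X_b lies in ball x r with probability at most 1 - kappa / phi r, uniformly in
   y; the ball is centred at x, so only the law of X_b, not a joint law of
   increments, enters.  By the Markov property at the times k b, the probability
   that X_(k b) lies in ball x (r_k) for all k <= n is at most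
   exp(- \sum_k kappa / phi (r_k)), where r_k = max(2^l varphi (k b), phi_inv b).
   Doubling of phi and the integral test make the sum diverge for every l, so
   almost surely d(X_(k b), x) >= 2^l varphi (k b) for arbitrarily large k. *)
Require Import Defs.
From mathcomp Require Import all_boot all_order all_algebra.
From mathcomp Require Import all_classical all_reals all_analysis.
From mathcomp Require Import measurable_realfun.
From mathcomp Require Import ring.

Import Order.TTheory GRing.Theory Num.Theory.
Import numFieldNormedType.Exports.

Local Open Scope classical_set_scope.
Local Open Scope ring_scope.

Set Implicit Arguments.
Unset Strict Implicit.

(** * Integral test on an arithmetic grid *)

(** On a cell of length [b] a nonincreasing [f] integrates to at most [b] times its value at the
    left endpoint. Partial sums all below [A] would bound the integral by [b * A]. *)
Lemma integral_test_divergence (R : realType) (f : R -> R) (T b A : R) :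
  0 < b ->
  (forall t, T <= t -> 0 <= f t) ->
  (forall s t, T <= s -> s <= t -> f t <= f s) ->
  (\int[lebesgue_measure]_(t in `]T, +oo[) (f t)%:E = +oo)%E ->
  exists n, A <= \sum_(i < n) f (T + i%:R * b).
Proof.
move=> b0 f0 fni foo; apply: contrapT => /forallNP bounded.
pose D i : set R := `[(T + i%:R * b), (T + i.+1%:R * b)[%classic.
have DE : \bigcup_i D i = `[T, +oo[%classic.
  apply/seteqP; split=> [t [i _]|t]; rewrite /D /= !in_itv/= ?andbT.
    by move=> /andP[+ _]; apply: le_trans; rewrite lerDl mulr_ge0// ltW.
  move=> Tt; exists (Num.truncn ((t - T) / b)) => //=; rewrite in_itv/=.
  have /truncn_itv/andP[] : 0 <= (t - T) / b.
    by rewrite divr_ge0 ?subr_ge0// ltW.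
  by rewrite ler_pdivlMr// ltr_pdivrMr// lerBrDl ltrBlDl => -> ->.
have mf : measurable_fun `[T, +oo[ (EFin \o f).
  apply/measurable_EFinP.
  (* Freezing [f] at its value in [T] to the left of [T] makes it monotone on the whole line. *)
  pose g : R -> R := fun t => f (Num.max t T).
  apply: (eq_measurable_fun g).
    by move=> t; rewrite inE/= in_itv/= andbT /g => Tt; rewrite max_l.
  apply: nonincreasing_measurable => // s t st.
  rewrite /g; apply: fni; first by rewrite le_max lexx orbT.
  by rewrite ge_max !le_max st lexx orbT.
have tD : trivIset setT D.
  suff idx i t : D i t -> i = Num.truncn ((t - T) / b).
    by move=> i j _ _ [t [/idx -> /idx ->]].
  rewrite /D /= in_itv/= => /andP[it ti]; symmetry; apply/truncn_def.
  by rewrite ler_pdivlMr// ltr_pdivrMr// lerBrDl ltrBlDl it.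
(* The half-open cells tile the closed half-line, whose integral dominates the one over the open
   half-line. *)
suff : (\int[lebesgue_measure]_(t in `[T, +oo[) (f t)%:E <= (b * A)%:E)%E.
  apply/negP; rewrite -ltNge (lt_le_trans (ltry (b * A)))// -foo.
  apply: ge0_subset_integral => //=.
    by move=> t; rewrite /= in_itv/= andbT lee_fin; exact: f0.
  by move=> t /=; rewrite !in_itv/= !andbT => /ltW.
rewrite -DE ge0_integral_bigcup//; last 3 first.
- by move=> i; exact: measurable_itv.
- by rewrite DE.
- by rewrite DE => t; rewrite /= in_itv/= andbT lee_fin; exact: f0.
apply: lime_le.
  apply: is_cvg_nneseries => i _ _; apply: integral_ge0 => t Dt.
  rewrite lee_fin f0//.
  have : (\bigcup_i D i) t by exists i.
  by rewrite DE /= in_itv/= andbT.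
apply: nearW => n.
apply: (@le_trans _ _ (b * \sum_(i < n) f (T + i%:R * b))%:E); last first.
  by rewrite lee_fin ler_pM2l// leNgt; apply/negP => /ltW /bounded.
rewrite mulr_sumr -sumEFin big_mkord; apply: lee_sum => i _.
have Ti : T <= T + i%:R * b by rewrite lerDl mulr_ge0// ltW.
apply: (@le_trans _ _
  (\int[lebesgue_measure]_(t in D i) (f (T + i%:R * b))%:E)%E).
  apply: ge0_le_integral => //=; first exact: measurable_itv.
  - move=> t; rewrite /D /= in_itv/= => /andP[it _].
    by rewrite lee_fin f0// (le_trans Ti).
  - apply: measurable_funS mf => //.
    by move=> t Dt; rewrite -DE; exists i.
  - move=> t; rewrite /D /= in_itv/= => /andP[it _].
    by rewrite lee_fin fni.
rewrite integral_cst; last exact: measurable_itv.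
have Di : lebesgue_measure (D i) = b%:E.
  rewrite /D lebesgue_measure_itv/= lte_fin ltrD2l ltr_pM2r// ltr_nat ltnSn.
  by rewrite -EFinB -natr1; congr _%:E; ring.
rewrite [X in (_ * X)%E](_ : _ = b%:E); last exact: Di.
by rewrite -EFinM lee_fin mulrC.
Qed.

(** * Borel sets and volumes *)

Lemma measurable_ball_metric (R : realType) (M : pointedMetricType R)
    (x : M) (r : R) :
  <<s (@open M) >> (ball x r).
Proof.
apply: sub_sigma_algebra; rewrite openE => y; rewrite ballEmdist/= => xy.
apply/nbhs_ballP; exists (r - mdist x y); first by rewrite /= subr_gt0.
move=> z; rewrite !ballEmdist/= ltrBrDl; exact/le_lt_trans/metric_triangle.
Qed.

Lemma measurable_some (T : topologicalType) (A : set T) :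
  <<s (@open T) >> A -> <<s (@open (cpt T)) >> (Some @` A).
Proof.
pose X := [set A | measurable (Some @` A : set (borel (cpt T)))] : set (set T).
have oX : @open T `<=` X.
  move=> U oU; apply: sub_sigma_algebra.
  exact: one_point_compactification_open_some.
suff : sigma_algebra setT X by move=> sX; exact: (smallest_sub sX oX).
split=> [|B XB|B XB]; rewrite /X /=.
- by rewrite image_set0; exact: measurable0.
- rewrite (_ : Some @` _ = Some @` [set: T] `\` Some @` B).
    by apply: measurableD => //; exact: (oX _ openT).
  apply/seteqP; split=> [_ [z [_ Bz] <-]|_ [[z _ <-] Bz]].
    by split; [exists z|case=> t Bt [tz]; apply: Bz; rewrite -tz].
  by exists z => //; split=> // Bz'; apply: Bz; exists z.
- by rewrite image_bigcup; exact: bigcupT_measurable.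
Qed.

(** The two removed balls weigh at most [2 * C * V r]. The assumption on [V s] makes this at most
    half of [C^-1 * V s], so the other half survives wherever [x] lies. *)
Lemma double_annulus_mass (R : realType) (M : pointedMetricType R)
    (mu : {measure set (borel M) -> \bar R}) (V : R -> R) (C r s : R) (x y : M) :
  1 <= C -> 0 < r -> 0 < s ->
  (forall (x : M) (r : R), 0 < r ->
    ((C^-1 * V r)%:E <= mu (ball x r) <= (C * V r)%:E)%E) ->
  4 * C ^+ 2 * V r <= V s ->
  (((2 * C)^-1 * V s)%:E <= mu (ball y s `\` (ball y r `|` ball x r)))%E.
Proof.
move=> C1 r0 s0 muB Vrs.
have C0 : 0 < C by exact: lt_le_trans C1.
have mB z t : measurable (ball z t : set (borel M)).
  exact: measurable_ball_metric.
have mU := measurableU _ _ (mB y r) (mB x r).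
have U_le : (mu (ball y r `|` ball x r) <= (2 * C * V r)%:E)%E.
  apply: le_trans (measureU2 _ _ _) _ => //.
  rewrite -mulrA mulr_natl mulr2n EFinD; apply: leeD.
    by have /andP[] := muB y r r0.
  by have /andP[] := muB x r r0.
have sub : (mu (ball y s) <= mu (ball y s `\` (ball y r `|` ball x r)) +
    mu (ball y r `|` ball x r))%E.
  apply: le_trans (measureU2 _ _ _) => //; last exact: measurableD.
  rewrite le_measure ?inE//; first by
    apply: measurableU => //; exact: measurableD.
  by move=> z Sz; have [|] := pselect ((ball y r `|` ball x r) z); [right|left].
have /andP[ballv _] := muB y s s0.
have : ((C^-1 * V s)%:E <= mu (ball y s `\` (ball y r `|` ball x r)) +
    (2 * C * V r)%:E)%E.
  by apply: (le_trans ballv); apply: (le_trans sub); rewrite leeD2l.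
rewrite -leeBlDr//; apply: le_trans; rewrite -EFinB lee_fin.
have -> : C^-1 * V s = (2 * C)^-1 * V s + (2 * C)^-1 * V s.
  by field; rewrite gt_eqF.
rewrite -addrA lerDl subr_ge0.
rewrite ler_pdivlMl ?mulr_gt0//.
apply: le_trans Vrs.
by rewrite le_eqVlt; apply/orP; left; apply/eqP; ring.
Qed.

(** * Markov property and heat kernel estimates *)

Lemma hunt_measurable (R : realType) (M : ptopologicalType)
    (dO : measure_display) (Omega : measurableType dO)
    (X : R -> Omega -> cpt M) (P : cpt M -> probability Omega R)
    (Ft : R -> set (set Omega)) (t : R) (B : set (cpt M)) :
  hunt_process X P Ft -> 0 <= t -> <<s (@open (cpt M)) >> B ->
  measurable (X t @^-1` B).
Proof.
move=> XH t0 sB; have HF := hp_filtration XH.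
exact/(af_sub HF t0)/(af_adapted HF).
Qed.

(** The strong Markov property is applied at the constant time [s]. Paths in [A] are alive at [s]
    and almost surely avoid [N], so the bound for starting points outside [N] applies to [X s w]. *)
Lemma markov_le (R : realType) (M : ptopologicalType)
    (mu : {measure set (borel M) -> \bar R})
    (dO : measure_display) (Omega : measurableType dO)
    (X : R -> Omega -> cpt M) (P : cpt M -> probability Omega R)
    (Ft : R -> set (set Omega)) (N : set M) (s b theta : R) (x : M)
    (A : set Omega) (B : set (cpt M)) :
  hunt_process X P Ft -> properly_exceptional X P mu N ->
  0 <= s -> 0 <= b -> 0 <= theta -> ~ N x ->
  Ft s A -> (forall w, A w -> X s w <> None) -> <<s (@open (cpt M)) >> B ->
  (forall y, ~ N y -> (P (Some y) (X b @^-1` B) <= theta%:E)%E) ->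
  (P (Some x) (A `&` X (s + b)%R @^-1` B) <= theta%:E * P (Some x) A)%E.
Proof.
move=> XH NE s0 b0 theta0 Nx FA AX sB PB; have HF := hp_filtration XH.
have mA := af_sub HF s0 FA.
have salg t : 0 <= t -> [/\ Ft t setT, Ft t set0 & setI_closed (Ft t)].
  move=> /(af_salg HF) /[dup] -[F0 _ _].
  by move=> /(sigma_algebraP (fun Y _ => @subsetT _ Y)).1[].
(* For a constant time, each event in the definition is either everything or empty. *)
have st : stopping_time Ft (fun=> s%:E).
  split=> [w|t t0]; first by rewrite lee_fin.
  have [FT F0 _] := salg _ t0.
  have [st|ts] := leP s t.
    rewrite [X in Ft t X](_ : _ = setT)//.
    by apply/seteqP; split=> // w _ /=; rewrite lee_fin.
  rewrite [X in Ft t X](_ : _ = set0)//.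
  by apply/seteqP; split=> // w /=; rewrite lee_fin leNgt ts.
have ssA : stopped_sigma Ft (fun=> s%:E) A.
  split=> // t t0; have [st'|ts] := leP s t.
    have [_ _ FI] := salg _ t0.
    by apply: FI; [exact: (af_mono HF s0 st')|exact: st.2].
  have [_ F0 _] := salg _ t0.
  rewrite [X in Ft t X](_ : _ = set0)//.
  by apply/seteqP; split=> // w [_] /=; rewrite lee_fin leNgt ts.
have -> : P (Some x) (A `&` X (s + b)%R @^-1` B) =
    (\int[P (Some x)]_(w in A) P (X s w) (X b @^-1` B))%E.
  exact: (hp_strong_markov XH (Some x) st ssA b0 sB).
have mX : measurable_fun [set: Omega] (X s : Omega -> borel (cpt M)).
  apply: (@measurability _ _ _ (borel (cpt M)) setT (X s) (@open (cpt M)))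
    => // _ [U oU <-].
  by rewrite setTI; apply: (hunt_measurable XH s0); exact: sub_sigma_algebra.
rewrite -integral_cst//; apply: ae_ge0_le_integral => //.
  apply: (@measurable_funS _ _ _ _ setT) => //.
  exact: (measurableT_comp (hp_kernel XH b0 sB)).
apply: filterS (pe_invariant NE Nx) => w Xw Aw /=.
case E : (X s w) (AX w Aw) => [y|//] _.
by apply: PB => Ny; exact: ((Xw _ Ny).1 s s0).
Qed.

(** Each further time costs a factor [1 - q i <= expR (- q i)]. The event at [i = 0] is bounded by 1
    only, hence [n.+1] events but [n] terms, starting at [q 1]. *)
Lemma markov_chain_le (R : realType) (M : ptopologicalType)
    (mu : {measure set (borel M) -> \bar R})
    (dO : measure_display) (Omega : measurableType dO)
    (X : R -> Omega -> cpt M) (P : cpt M -> probability Omega R)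
    (Ft : R -> set (set Omega)) (N : set M) (s b : R) (x : M)
    (B : nat -> set M) (q : nat -> R) (n : nat) :
  hunt_process X P Ft -> properly_exceptional X P mu N ->
  0 <= s -> 0 <= b -> ~ N x ->
  (forall i, <<s (@open (cpt M)) >> (Some @` B i)) ->
  (forall i y, ~ N y ->
    (P (Some y) (X b @^-1` (Some @` B i)) <= (1 - q i)%R%:E)%E) ->
  (P (Some x) (\big[setI/setT]_(i < n.+1) X (s + i%:R * b)%R @^-1` (Some @` B i))
    <= (expR ((- \sum_(i < n) q i.+1)%R))%:E)%E.
Proof.
move=> XH NE s0 b0 Nx sB PB; have HF := hp_filtration XH.
pose A n := \big[setI/setT]_(i < n.+1) X (s + i%:R * b)%R @^-1` (Some @` B i).
have t0 k : 0 <= s + k%:R * b by rewrite addr_ge0// mulr_ge0.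
have FA k : Ft (s + k%:R * b) (A k).
  elim: k => [|k IH]; first by rewrite /A big_ord1; exact: (af_adapted HF).
  rewrite /A big_ord_recr/=.
  have /(sigma_algebraP (fun Y _ => @subsetT _ Y)).1[_ _ _ FI] :=
    af_salg HF (t0 k.+1).
  apply: FI; last exact: (af_adapted HF).
  by apply: (af_mono HF (t0 k)) IH; rewrite lerD2l ler_wpM2r// ler_nat.
rewrite -/(A n); elim: n => [|n IH].
  rewrite big_ord0 oppr0 expR0 probability_le1//.
  exact: (af_sub HF (t0 0%N) (FA 0%N)).
rewrite {1}/A big_ord_recr/= -/(A n).
(* This number bounds a probability from above, namely the one started at [x]. *)
have q1 : 0 <= 1 - q n.+1.
  by rewrite -lee_fin; apply: le_trans (PB n.+1 x Nx).
have -> : s + n.+1%:R * b = s + n%:R * b + b.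
  by rewrite -natr1 mulrDl mul1r addrA.
apply: (le_trans (markov_le XH NE (t0 n) b0 q1 Nx (FA n) _ (sB _) (PB n.+1))).
  by move=> w; rewrite /A big_ord_recr/= => -[_ [y _ <-]].
rewrite big_ord_recr/= opprD expRD mulrC EFinM; apply: lee_pmul => //.
by rewrite lee_fin; exact: expR_ge1Dx.
Qed.

(** Functions vanish at the cemetery, so the probability is the semigroup applied to the indicator
    of [D], that is, the integral of [p t y] over [D]. *)
Lemma heat_kernel_lower_mass (R : realType) (M : ptopologicalType)
    (mu : {measure set (borel M) -> \bar R})
    (dO : measure_display) (Omega : measurableType dO)
    (X : R -> Omega -> cpt M) (P : cpt M -> probability Omega R)
    (Ft : R -> set (set Omega)) (N : set M) (p : R -> M -> M -> R)
    (t k : R) (y : M) (D : set M) :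
  hunt_process X P Ft -> heat_kernel X P mu N p ->
  0 < t -> 0 <= k -> ~ N y -> <<s (@open M) >> D ->
  {ae mu, forall z, D z -> k <= p t y z} ->
  (k%:E * mu D <= P (Some y) (X t @^-1` (Some @` D)))%E.
Proof.
move=> XH pH t0 k0 Ny sD pD.
have mD : measurable (D : set (borel M)) by [].
have m1 : measurable_fun [set: borel M] (EFin \o \1_D : borel M -> \bar R).
  by apply/measurable_EFinP; exact: measurable_indic.
have mp : measurable_fun [set: borel M] (fun z : borel M => (p t y z)%:E).
  apply/measurable_EFinP.
  (* Joint measurability of [p] is available on positive times only; the section at [(t, y)] stays
     in that set. *)
  apply: (measurable_comp (F := [set z : R * borel M * borel M | 0 < z.1.1])
    (g := pair (t, y : borel M)) _ _ (hk_meas pH)).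
  - rewrite [X in measurable X](_ : _ =
      [set: R * borel M * borel M] `&` (fst \o fst) @^-1` `]0, +oo[).
      apply: measurableT_comp => //; exact: measurable_fst.
    by apply/seteqP; split=> z /=; rewrite in_itv/= andbT => // -[].
  - by move=> _ [z _ <-].
  - exact: pair1_measurable.
have -> : P (Some y) (X t @^-1` (Some @` D)) =
    semigroup X P t (EFin \o \1_D) y.
  rewrite -[in LHS](setIT (_ @^-1` _)) -integral_indic//; last first.
    by apply: (hunt_measurable XH (ltW t0)); exact: measurable_some.
  apply: eq_integral => w _ /=; rewrite !indicE.
  case Xw : (X t w) => [z|]; last by rewrite memNset//= Xw => -[].
  suff -> : (w \in X t @^-1` (Some @` D)) = (z \in D) by rewrite indicE.
  apply/idP/idP => /set_mem.
    by rewrite /= Xw => -[z' Dz' [<-]]; apply/mem_set.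
  by move=> Dz; apply/mem_set; rewrite /= Xw; exists z.
have D0 z : (0 <= (EFin \o \1_D : M -> \bar R) z)%E by rewrite lee_fin.
rewrite (hk_density pH t0 Ny m1 D0).
have -> : (k%:E * mu D = \int[mu]_z (k%:E * (\1_D z)%:E))%E.
  by rewrite ge0_integralZl// integral_indic// setIT.
apply: ae_ge0_le_integral => //.
- by move=> z _; rewrite mule_ge0 ?lee_fin.
- exact: emeasurable_funM.
- by move=> z _; rewrite mule_ge0 ?lee_fin// (hk_ge0 pH).
- exact: emeasurable_funM.
apply: (@filterS _ _ (ae_filter_ringOfSetsType mu) _ _ _ pD) => z Dz _ /=; rewrite indicE.
have [/set_mem/Dz kz|_] := boolP (z \in D); last by rewrite !mule0.
by rewrite !mule1 lee_fin.
Qed.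

(** The event of never leaving lies in every finite intersection, so its probability is below [expR]
    of minus arbitrarily large sums. *)
Lemma ae_exists_exit (R : realType) (M : ptopologicalType)
    (mu : {measure set (borel M) -> \bar R})
    (dO : measure_display) (Omega : measurableType dO)
    (X : R -> Omega -> cpt M) (P : cpt M -> probability Omega R)
    (Ft : R -> set (set Omega)) (N : set M) (s b : R) (x : M)
    (B : nat -> set M) (q : nat -> R) :
  hunt_process X P Ft -> properly_exceptional X P mu N ->
  0 <= s -> 0 <= b -> ~ N x ->
  (forall i, <<s (@open (cpt M)) >> (Some @` B i)) ->
  (forall i y, ~ N y ->
    (P (Some y) (X b @^-1` (Some @` B i)) <= (1 - q i)%R%:E)%E) ->
  (forall A, exists n, A <= \sum_(i < n) q i.+1) ->
  {ae P (Some x), forall w, exists i, ~ (Some @` B i) (X (s + i%:R * b) w)}.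
Proof.
move=> XH NE s0 b0 Nx sB PB qoo.
pose A i := X (s + i%:R * b) @^-1` (Some @` B i).
have mA i : measurable (A i).
  by apply: (hunt_measurable XH) => //; rewrite addr_ge0// mulr_ge0.
have PA n : (P (Some x) (\bigcap_i A i) <=
    (expR (- \sum_(i < n) q i.+1)%R)%:E)%E.
  apply: le_trans (markov_chain_le n XH NE s0 b0 Nx sB PB).
  rewrite le_measure ?inE//; first exact: bigcapT_measurable.
    by apply: bigsetI_measurable => i _; exact: mA.
  by rewrite -(bigcap_mkord n.+1 A) => w Aw i _; exact: Aw.
exists (\bigcap_i A i); split; first exact: bigcapT_measurable.
  apply/eqP; rewrite eq_le measure_ge0 andbT leNgt; apply/negP => P0.
  have Pfin : P (Some x) (\bigcap_i A i) \is a fin_num.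
    by apply: fin_num_measure; exact: bigcapT_measurable.
  move: P0 PA; rewrite -(fineK Pfin); move: (fine _) => e.
  (* A positive probability [e] would satisfy [e <= expR (- e^-1)], but
     [expR (e^-1) >= 1 + e^-1 > e^-1]. *)
  rewrite lte_fin => e0 PA; have [n en] := qoo e^-1.
  have := PA n; rewrite lee_fin leNgt => /negP; apply.
  apply: (@le_lt_trans _ _ (expR (- e^-1))); first by rewrite ler_expR lerN2.
  rewrite expRN invf_plt ?posrE ?expR_gt0//.
  by apply: lt_le_trans (expR_ge1Dx _); rewrite ltrDr.
by move=> w /= /forallNP Aw i _; exact: contrapT (Aw i).
Qed.

(** * Limsup criterion and powers of two *)

Lemma limf_esup_pinfty (R : realType) (f : R -> \bar R) :
  (forall T A : R, exists2 t, T < t & (A%:E <= f t)%E) ->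
  limf_esup f (+oo : set_system R) = +oo%E.
Proof.
move=> foo; apply/eqP; rewrite -leye_eq; apply: le_ereal_inf_tmp => _ [W [T [_ TW]] <-].
rewrite leye_eq; apply/eqP/eq_infty => A; have [t Tt At] := foo T A.
by apply: le_trans At _; apply: ereal_sup_ubound; exists t => //; exact: TW.
Qed.

Lemma doubling_iter (R : realType) (phi : R -> R) (c : R) (j : nat) (r : R) :
  0 <= c -> (forall r, 0 < r -> phi (2 * r) <= c * phi r) -> 0 < r ->
  phi (2 ^+ j * r) <= c ^+ j * phi r.
Proof.
move=> c0 phi2 r0; elim: j => [|j IH]; first by rewrite !expr0 !mul1r.
rewrite !exprS -!mulrA; apply: (le_trans (phi2 _ _)).
  by rewrite mulr_gt0// exprn_gt0.
by rewrite ler_wpM2l.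
Qed.

(** Used with [d = d1] to choose the ratio of the annulus radii, and with [d = 1] to choose the
    multiple of [varphi] to be exceeded. *)
Lemma pow2_powR_ge (R : realType) (d A : R) : 0 < d -> exists j, A <= (2 ^+ j) `^ d.
Proof.
move=> d0; have [A0|A0] := leP A 0; first by exists 0%N; exact: le_trans (powR_ge0 _ _).
pose j := (Num.truncn (A `^ d^-1)).+1; exists j.
have -> : A = (A `^ d^-1) `^ d.
  by rewrite -powRrM mulVf ?lt0r_neq0// powRr1// ltW.
apply: ge0_ler_powR; rewrite ?nnegrE ?powR_ge0 ?exprn_ge0//; first exact: ltW.
apply/ltW; apply: (lt_trans (truncnS_gt _)).
by rewrite -natrX ltr_nat ltn_expl.
Qed.

(** * One-step escape from a ball *)

(** With [s = 2 ^+ j * r], the kernel bound [C * b / (V s * phi s)] times the annulus mass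
    [V s / (2 * Cstar)] is free of [V]. Doubling then replaces [phi s] by [c ^+ j * phi r]. *)
Lemma ball_stay_probability (R : realType) (M : pointedMetricType R)
    (mu : {measure set (borel M) -> \bar R}) (V phi : R -> R)
    (dO : measure_display) (Omega : measurableType dO)
    (X : R -> Omega -> cpt M) (P : cpt M -> probability Omega R)
    (Ft : R -> set (set Omega)) (N : set M) (p : R -> M -> M -> R)
    (Cstar C c b r : R) (j : nat) (x y : M) :
  hunt_process X P Ft -> heat_kernel X P mu N p ->
  1 <= Cstar -> 0 < C -> 0 <= c -> 0 < b -> 0 < r -> ~ N y ->
  (forall r, 0 < r -> 0 < V r) ->
  (forall r s, 0 < r -> r < s -> V r < V s) ->
  (forall (x : M) (r : R), 0 < r ->
    ((Cstar^-1 * V r)%:E <= mu (ball x r) <= (Cstar * V r)%:E)%E) ->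
  (forall r, 0 < r -> 0 < phi r) ->
  (forall r s, 0 < r -> r < s -> phi r < phi s) ->
  (forall r, 0 < r -> phi (2 * r) <= c * phi r) ->
  {ae mu, forall z, r <= mdist y z ->
    C * b / (V (mdist y z) * phi (mdist y z)) <= p b y z} ->
  4 * Cstar ^+ 2 * V r <= V (2 ^+ j * r) ->
  (P (Some y) (X b @^-1` (Some @` ball x r)) <=
    (1 - C * b / (2 * Cstar * c ^+ j) / phi r)%R%:E)%E.
Proof.
move=> XH pH Cstar1 C0 c0 b0 r0 Ny V0 Vinc muB phi0 phiinc phi2 plow Vj.
set s := 2 ^+ j * r in Vj *.
have s0 : 0 < s by rewrite mulr_gt0// exprn_gt0.
have Cs0 : 0 < Cstar by exact: lt_le_trans Cstar1.
have sball z t : <<s (@open M) >> (ball z t) by exact: measurable_ball_metric.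
(* Removing [ball y r] makes the kernel bound applicable; removing [ball x r] makes the event
   disjoint from staying. *)
pose D : set M := ball y s `\` (ball y r `|` ball x r).
have sD : <<s (@open M) >> D.
  have mb z t : measurable (ball z t : set (borel M)) by exact: sball.
  exact: (measurableD (mb y s) (measurableU _ _ (mb y r) (mb x r))).
pose k := C * b / (V s * phi s).
(* As [V] and [phi] increase, the kernel bound on [D] is smallest at the outer radius [s]; this is
   [k]. *)
have k0 : 0 <= k by rewrite divr_ge0// ?mulr_ge0 ?ltW// ?V0 ?phi0.
have pD : {ae mu, forall z, D z -> k <= p b y z}.
  apply: (@filterS _ _ (ae_filter_ringOfSetsType mu) _ _ _ plow) => z plowz.
  rewrite /D /= ballEmdist/= => -[yzs /not_orP[+ _]].
  rewrite ballEmdist/= => /negP; rewrite -leNgt => ryz.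
  apply: le_trans (plowz ryz).
  have yz0 : 0 < mdist y z by exact: lt_le_trans ryz.
  rewrite /k ler_pM2l ?mulr_gt0// lef_pV2 ?posrE ?mulr_gt0 ?V0 ?phi0//.
  by apply: ler_pM; rewrite ltW// ?V0 ?phi0 ?Vinc ?phiinc.
have DP := heat_kernel_lower_mass XH pH b0 k0 Ny sD pD.
have muD := double_annulus_mass x y Cstar1 r0 s0 muB Vj.
have kD : ((C * b / (2 * Cstar * c ^+ j) / phi r)%:E <=
    P (Some y) (X b @^-1` (Some @` D)))%E.
  apply: le_trans DP.
  apply: (@le_trans _ _ (k%:E * ((2 * Cstar)^-1 * V s)%:E)%E); last first.
    by apply: lee_wpmul2l => //; rewrite lee_fin.
  rewrite -EFinM lee_fin.
  have -> : k * ((2 * Cstar)^-1 * V s) = C * b / (2 * Cstar) / phi s.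
    by rewrite /k; field; rewrite !gt_eqF ?V0 ?phi0.
  (* Only [0 <= c] is assumed; positivity comes from [0 < phi s <= c ^+ j * phi r]. *)
  have c0' : 0 < c ^+ j * phi r.
    exact: lt_le_trans (phi0 _ s0) (doubling_iter j c0 phi2 r0).
  rewrite [leLHS](_ : _ = C * b / (2 * Cstar) / (c ^+ j * phi r)); last by rewrite !invfM !mulrA.
  rewrite ler_pM2l ?divr_gt0 ?mulr_gt0// lef_pV2 ?posrE ?phi0//.
  exact: doubling_iter.
have mX E : <<s (@open M) >> E -> measurable (X b @^-1` (Some @` E)).
  by move=> sE; apply: (hunt_measurable XH (ltW b0)); exact: measurable_some.
have mXb := mX _ (sball x r); have mXD := mX _ sD.
have : (P (Some y) (X b @^-1` (Some @` ball x r)) +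
    P (Some y) (X b @^-1` (Some @` D)) <= 1)%E.
  rewrite -measureU//; first by apply: probability_le1; exact: measurableU.
  apply/seteqP; split=> // w [[z xz zw] [z' [_ yz'] z'w]].
  by apply: yz'; right; move: zw; rewrite -z'w => -[<-].
rewrite EFinB leeBrDr//; apply: le_trans.
by rewrite leeD2l.
Qed.

(** * Almost sure divergence of the limsup *)

Unset Implicit Arguments.
Set Strict Implicit.

Theorem theorem3p3 (R : realType) (M : pointedMetricType R)
  (M_locally_compact : locally_compact [set: M])
  (M_separable : separable M)
  (M_connected : connected [set: M])
  (M_balls : forall (x : M) (r : R), 0 < r -> precompact (ball x r))
  (mu : {measure set (borel M) -> \bar R})
  (mu_radon : radon_on [set: M] mu)
  (mu_full_support : full_support mu)
  (V phi phi_inv : R -> R)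
  (V_gt0 : forall r, 0 < r -> 0 < V r)
  (V_increasing : forall r s, 0 < r -> r < s -> V r < V s)
  (V_at_0 : V r @[r --> 0^'+] --> (0 : R))
  (V_at_oo : V r @[r --> +oo] --> +oo)
  (Cstar : R) (Cstar_ge1 : 1 <= Cstar)
  (mu_balls : forall (x : M) (r : R), 0 < r ->
    ((Cstar^-1 * V r)%:E <= mu (ball x r) <= (Cstar * V r)%:E)%E)
  (phi_gt0 : forall r, 0 < r -> 0 < phi r)
  (phi_increasing : forall r s, 0 < r -> r < s -> phi r < phi s)
  (phi_inv_gt0 : forall t, 0 < t -> 0 < phi_inv t)
  (phiK : forall r, 0 < r -> phi_inv (phi r) = r)
  (phi_invK : forall t, 0 < t -> phi (phi_inv t) = t)
  (F : set (M -> R)) (E : (M -> R) -> (M -> R) -> R)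
  (E_dirichlet : dirichlet_form mu F E)
  (E_regular : regular_form mu F E)
  (E_pure_jump : pure_jump F E)
  (dO : measure_display) (Omega : measurableType dO)
  (X : R -> Omega -> cpt M) (P : cpt M -> probability Omega R)
  (Ft : R -> set (set Omega))
  (X_hunt : hunt_process X P Ft)
  (X_associated : associated X P mu F E)
  (N : set M) (N_exceptional : properly_exceptional X P mu N)
  (p : R -> M -> M -> R) (p_heat_kernel : heat_kernel X P mu N p)
  (a C : R) (a_gt0 : 0 < a) (C_gt0 : 0 < C)
  (p_lower : forall x : M, ~ N x -> {ae mu, forall y : M, forall t : R, a < t ->
    phi_inv t <= mdist x y ->
    C * t / (V (mdist x y) * phi (mdist x y)) <= p t x y})
  (c1 c2 d1 d2 c : R) (c1_gt0 : 0 < c1) (c2_gt0 : 0 < c2)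
  (d1_gt0 : 0 < d1) (d1_le_d2 : d1 <= d2) (c_gt1 : 1 < c)
  (V_scaling : forall r s : R, 0 < r -> r < s ->
    c1 * (s / r) `^ d1 <= V s / V r <= c2 * (s / r) `^ d2)
  (phi_doubling : forall r, 0 < r -> phi (2 * r) <= c * phi r)
  (varphi : R -> R)
  (varphi_gt0 : forall t, 1 < t -> 0 < varphi t)
  (varphi_increasing : forall s t, 1 < s -> s <= t -> varphi s <= varphi t)
  (* the integral diverges at infinity *)
  (varphi_integral : forall T : R, 1 < T ->
    (\int[lebesgue_measure]_(t in `]T, +oo[) ((phi (varphi t))^-1)%:E = +oo)%E) :
  forall x : M, ~ N x ->
  {ae P (Some x), forall w : Omega,
    limf_esup (fun t : R =>
      (ereal_sup [set dist_to x (X s w) | s in `]0%R, t]] * (varphi t)^-1%:E)%E)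
      (+oo : set_system R) = +oo%E /\
    limf_esup (fun t : R => (dist_to x (X t w) * (varphi t)^-1%:E)%E)
      (+oo : set_system R) = +oo%E}.
Proof.
move=> x Nx.
pose b := a + 1.
have b1 : 1 <= b by rewrite lerDr ltW.
have b0 : 0 < b by exact: lt_le_trans b1.
have rho0 := phi_inv_gt0 b b0; set rho := phi_inv b in rho0.
have c0 : 0 <= c by exact: ltW (lt_trans ltr01 c_gt1).
have Cs0 : 0 < Cstar by exact: lt_le_trans Cstar_ge1.
have phi_le r s : 0 < r -> r <= s -> phi r <= phi s.
  by move=> r0; rewrite le_eqVlt => /orP[/eqP->//|rs]; exact/ltW/phi_increasing.
have [j0 j0P] := @pow2_powR_ge R d1 (4 * Cstar ^+ 2 / c1) d1_gt0.
(* The successor ensures [1 < 2 ^+ j], since [V_scaling] compares strictly ordered radii. *)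
pose j := j0.+1.
have VK r : 0 < r -> 4 * Cstar ^+ 2 * V r <= V (2 ^+ j * r).
  move=> r0; have two_j : 1 < 2 ^+ j :> R by rewrite exprn_egt1// ltr1n.
  have rr : r < 2 ^+ j * r by rewrite ltr_pMl.
  have /andP[+ _] := V_scaling r _ r0 rr.
  rewrite mulfK ?gt_eqF// ler_pdivlMr ?V_gt0//; apply: le_trans.
  rewrite ler_pM2r ?V_gt0// -ler_pdivrMl// mulrC (le_trans j0P)//.
  by rewrite ge0_ler_powR ?nnegrE ?exprn_ge0 ?ltW// ltr_eXn2l ?ltr1n.
pose kappa := C * b / (2 * Cstar * c ^+ j).
have kappa0 : 0 < kappa.
  by rewrite divr_gt0 ?mulr_gt0 ?exprn_gt0// (lt_trans ltr01).
have stay r y : rho <= r -> ~ N y ->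
    (P (Some y) (X b @^-1` (Some @` ball x r)) <= (1 - kappa / phi r)%R%:E)%E.
  move=> rho_r Ny; have r0 : 0 < r by exact: lt_le_trans rho_r.
  apply: (ball_stay_probability x X_hunt p_heat_kernel Cstar_ge1 C_gt0 c0 b0
    r0 Ny V_gt0 V_increasing mu_balls phi_gt0 phi_increasing phi_doubling _ (VK r r0)).
  apply: (@filterS _ _ (ae_filter_ringOfSetsType mu) _ _ _ (p_lower y Ny)).
  move=> z + rz; apply; first by rewrite ltrDl.
  exact: le_trans rho_r rz.
(* Countably many [l] (height) and [m] (starting time) allow one common null set. The shift [m.+2]
   keeps all times at least 2, where [varphi 2] is a lower bound for [varphi]. *)
have exits : {ae P (Some x), forall w, forall l m : nat, exists i : nat,
    ~ (Some @` ball x (Num.max (2 ^+ l * varphi (m.+2%:R * b + i%:R * b)) rho))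
        (X (m.+2%:R * b + i%:R * b) w)}.
  apply/ae_foralln => l; apply/ae_foralln => m.
  pose s := m.+2%:R * b; pose tt i := s + i%:R * b.
  have s2 : 2 <= s.
    by rewrite -[leLHS]mulr1 ler_pM// ler_nat.
  have s1 : 1 < s by rewrite (lt_le_trans _ s2)// ltr1n.
  have s0 : 0 <= s by exact: ltW (lt_trans ltr01 s1).
  pose r i := Num.max (2 ^+ l * varphi (tt i)) rho.
  apply: (@ae_exists_exit _ _ mu _ _ X P Ft N s b x (fun i => ball x (r i))
    (fun i => kappa / phi (r i))) => //.
  - exact: ltW.
  - by move=> i; apply: measurable_some; exact: measurable_ball_metric.
  - by move=> i y; apply: stay; rewrite le_max lexx orbT.
  move=> A; have v2 : 0 < varphi 2 by rewrite varphi_gt0// ltr1n.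
  (* Chosen so that [phi (r i.+1) <= Lam * phi (varphi (tt i.+1))]. *)
  pose Lam := c ^+ l + phi rho / phi (varphi 2).
  have Lam0 : 0 < Lam.
    by rewrite addr_gt0 ?exprn_gt0 ?divr_gt0 ?phi_gt0// (lt_trans ltr01).
  have sb1 : 1 < s + b by rewrite (lt_trans s1)// ltrDl.
  have g_gt0 t : s + b <= t -> 0 < (phi (varphi t))^-1.
    by move=> st; rewrite invr_gt0 phi_gt0// varphi_gt0// (lt_le_trans sb1).
  have g_anti t u : s + b <= t -> t <= u ->
      (phi (varphi u))^-1 <= (phi (varphi t))^-1.
    move=> st tu; have t1 : 1 < t by exact: lt_le_trans st.
    rewrite lef_pV2 ?posrE ?phi_gt0 ?varphi_gt0// ?(lt_le_trans t1)//.
    by apply: phi_le; [exact: varphi_gt0|exact: varphi_increasing].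
  (* The test starts at [s + b], which is [tt 1], because the exit criterion sums from index 1. *)
  have [n nA] := integral_test_divergence (A / (kappa / Lam)) b0
    (fun t st => ltW (g_gt0 t st)) g_anti (varphi_integral _ sb1).
  have kLam : 0 < kappa / Lam by exact: divr_gt0.
  exists n; move: nA; rewrite ler_pdivrMr ?invr_gt0// => /le_trans; apply.
  rewrite mulrC mulr_sumr; apply: ler_sum => i _.
  have -> : s + b + i%:R * b = tt i.+1 by rewrite /tt -natr1; ring.
  have tt2 : 2 <= tt i.+1.
    by rewrite (le_trans s2)// lerDl mulr_ge0// ltW.
  have v_tt : 0 < varphi (tt i.+1).
    by rewrite varphi_gt0// (lt_le_trans _ tt2)// ltr1n.
  rewrite -mulrA -invfM ler_pM2l// lef_pV2 ?posrE ?mulr_gt0 ?phi_gt0//; last first.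
    by rewrite lt_max rho0 orbT.
  (* Monotonicity of [varphi] on [2, oo) absorbs the truncation at [rho] into
     the constant [Lam]. *)
  apply: (@le_trans _ _ (c ^+ l * phi (varphi (tt i.+1)) + phi rho)).
    have cl : 0 <= c ^+ l * phi (varphi (tt i.+1)).
      by rewrite mulr_ge0 ?exprn_ge0//; exact/ltW/phi_gt0.
    rewrite /r maxEle; case: ifP => _; first by rewrite lerDr.
    by rewrite (le_trans (doubling_iter l c0 phi_doubling v_tt))// lerDl ltW// phi_gt0.
  rewrite mulrDl lerD2l mulrAC ler_pdivlMr ?phi_gt0// ler_pM2l ?phi_gt0//.
  by apply: phi_le => //; apply: varphi_increasing => //; rewrite ltr1n.
apply: (@filterS _ _ (ae_filter_ringOfSetsType (P (Some x))) _ _ _ exits) => w Xw.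
have far T A : exists2 t, Num.max T 1 < t &
    (A%:E <= dist_to x (X t w) * (varphi t)^-1%:E)%E.
  have [l lA] := @pow2_powR_ge R 1 A ltr01.
  (* Then [m.+1] already exceeds both [T] and 1, and so does every grid time, as [1 <= b]. *)
  pose m := Num.truncn (Num.max T 1).
  have [i Xi] := Xw l m.
  set t := m.+2%:R * b + i%:R * b in Xi *.
  have mt : Num.max T 1 < t.
    apply: (lt_le_trans (truncnS_gt _)); apply: (@le_trans _ _ (m.+2%:R * b)).
      by rewrite -[leLHS]mulr1 ler_pM// ler_nat.
    by rewrite lerDl mulr_ge0// ltW.
  have t1 : 1 < t by apply: le_lt_trans mt; rewrite le_max lexx orbT.
  have vt := varphi_gt0 t t1.
  exists t => //; move: Xi; rewrite /dist_to; case: (X t w) => [y|_]; last first.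
    (* At the cemetery the distance, hence the quotient, is [+oo]. *)
    by rewrite mulyr gtr0_sg ?invr_gt0// mul1e leey.
  move=> Xy; rewrite -EFinM lee_fin ler_pdivlMr//.
  have : 2 ^+ l * varphi t <= mdist x y.
    rewrite leNgt; apply/negP => yr; apply: Xy; exists y => //.
    by rewrite ballEmdist/= lt_max yr.
  rewrite metric_sym; apply: le_trans.
  by rewrite ler_pM2r//; move: lA; rewrite powRr1// exprn_ge0.
split; apply: limf_esup_pinfty => T A; have [t] := far T A;
  rewrite gt_max => /andP[Tt t1] At; exists t => //.
(* What remains is the running supremum, which dominates its term at [s = t]. *)
apply: (le_trans At); apply: lee_wpmul2r.
  by rewrite lee_fin invr_ge0 ltW// varphi_gt0.
apply: ereal_sup_ubound; exists t => //=.
by rewrite in_itv/= lexx (lt_trans ltr01 t1).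
Qed.
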